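(* Let $1\to N\to G\xrightarrow{\pi}Q\to1$ be a short exact sequence of groups, $M$ a $G$-module, and $\alpha:Q\to G$ a section of $\pi$ with factor set $f_\alpha:Q\times Q\to N$, i.e. $\alpha(q)\alpha(q')=f_\alpha(q,q')\alpha(qq')$. Let $d:N\to M$ be a derivation with $[d]\in H^1(N,M)^Q$, let $s:N\to M\rtimes G$, $s(n)=(d(n),n)$, and $H=s(N)$. Let $\widetilde s:G\to N_{M\rtimes G}(H)$ be a section (not necessarily a homomorphism) of the projection $N_{M\rtimes G}(H)\to G$, and let $f_s:G\times G\to M^N$ be defined by $\widetilde s(g)\widetilde s(g')=(f_s(g,g'),1)\,\widetilde s(gg')$. (i) If $\widetilde s$ extends $s$, then $\mathrm{tr}[d]$ is represented by the cocycle $F:Q\times Q\to M^N$, $$F(q_1,q_2)=f_s(\alpha(q_1),\alpha(q_2))-f_s(f_\alpha(q_1,q_2),\alpha(q_1q_2)).$$ (ii) In general (with $\widetilde s$ not necessarily extending $s$), $\mathrm{tr}[d]$ is represented by the cocycle $F:Q\times Q\to M^N$, $$F(q_1,q_2)=f_s(\alpha(q_1),\alpha(q_2))-f_s(f_\alpha(q_1,q_2),\alpha(q_1q_2))+\overline i^{-1}\big(\widetilde s(f_\alpha(q_1,q_2))H\big),$$ where $\overline i:M^N\to N_{M\rtimes G}(H)/H$ is the injection $m\mapsto(m,1)H$.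
   Context: $N$ is regarded as a normal subgroup of $G$; $M$ is written additively. $M\rtimes G$ has law $(m,g)(m',g')=(m+g\cdot m',gg')$. $H^1(N,M)=\mathrm{Der}(N,M)/\mathrm{Inn}(N,M)$ is a $Q$-module via $({}^gd)(n)=g\cdot d(g^{-1}ng)$. When $[d]\in H^1(N,M)^Q$, the sequence $0\to M^N\to N_{M\rtimes G}(H)\to G\to1$ is exact. The map $\mathrm{tr}:H^1(N,M)^Q\to H^2(Q,M^N)$ sends $[d]$ to the class of the extension $0\to M^N\xrightarrow{\overline i}N_{M\rtimes G}(H)/H\to Q\to1$, whose second map is induced by $(m,g)\mapsto\pi(g)$. The cocycle $F$ of an extension $0\to A\xrightarrow{\iota}E\to Q\to 1$ with respect to a section $\sigma:Q\to E$ is given by $\sigma(q_1)\sigma(q_2)=\iota(F(q_1,q_2))\,\sigma(q_1q_2)$. *)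

(* Defs.v *)
From HB Require Import structures.
From mathcomp Require Import all_boot ssralg ring_quotient.
From mathcomp Require Import boolp classical_sets functions.

Set Implicit Arguments.
Unset Strict Implicit.
Unset Printing Implicit Defensive.

Import GRing.Theory.
Local Open Scope group_scope.
Local Open Scope quotient_scope.

(* Partial inverse of a map into a group: when f is injective and y = f a,   *)
(* preimg f y is a; outside the range of f its value is irrelevant.           *)
Definition preimg (A : groupType) (T : Type) (f : A -> T) (y : T) : A :=
  xget 1 [set a | f a = y]%classic.

Lemma preimgK (A : groupType) (T : Type) (f : A -> T) y :
  (exists a, f a = y) -> f (preimg f y) = y.
Proof. by move=> fy; apply: (xgetPex 1 fy). Qed.

Lemma preimgE (A : groupType) (T : Type) (f : A -> T) a :
  injective f -> preimg f (f a) = a.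
Proof. by move=> finj; apply: finj; apply: preimgK; exists a. Qed.

Record short_exact (A E Q : groupType) := ShortExact {
  ses_i : UMagmaMorphism.type A E;
  ses_p : UMagmaMorphism.type E Q;
  ses_inj : injective ses_i;
  ses_exact : forall e, ses_p e = 1 <-> exists a, ses_i a = e;
  ses_surj : forall q, exists e, ses_p e = q
}.

Lemma ses_pi (A E Q : groupType) (S : short_exact A E Q) a :
  ses_p S (ses_i S a) = 1.
Proof. by apply/ses_exact; exists a. Qed.

Definition sect (A E Q : groupType) (S : short_exact A E Q) (q : Q) : E :=
  projT1 (cid (ses_surj S q)).

Lemma sectK (A E Q : groupType) (S : short_exact A E Q) q :
  ses_p S (sect S q) = q.
Proof. exact: projT2 (cid (ses_surj S q)). Qed.

Record gmodule (G : groupType) (M : zmodType) := GModule {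
  gact :> G -> M -> M;
  gact1 : forall m, gact 1 m = m;
  gactM : forall g h m, gact (g * h) m = gact g (gact h m);
  gactD : forall g m m', gact g (m + m')%R = (gact g m + gact g m')%R
}.

Section ModuleTheory.
Variables (G : groupType) (M : zmodType) (rho : gmodule G M).

Lemma gact0 g : rho g 0%R = 0%R.
Proof. by apply: (addrI (rho g 0%R)); rewrite -gactD !addr0. Qed.

Lemma gactN g m : rho g (- m)%R = (- rho g m)%R.
Proof.
by apply: (addrI (rho g m)); rewrite -gactD !subrr gact0.
Qed.

Lemma gactB g m m' : rho g (m - m')%R = (rho g m - rho g m')%R.
Proof. by rewrite gactD gactN. Qed.

Lemma gactK g m : rho g^-1 (rho g m) = m.
Proof. by rewrite -gactM mulVg gact1. Qed.

Lemma gactKV g m : rho g (rho g^-1 m) = m.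
Proof. by rewrite -gactM mulgV gact1. Qed.

Definition is_invariant (m : M) : Prop := forall g, rho g m = m.
Definition inv_pred : {pred M} := [pred m | `[< is_invariant m >]].

Lemma inv_zmod_closed : zmod_closed inv_pred.
Proof.
split=> [|x y /asboolP Hx /asboolP Hy]; apply/asboolP => g; first exact: gact0.
by rewrite gactB Hx Hy.
Qed.
HB.instance Definition _ := GRing.isZmodClosed.Build M inv_pred inv_zmod_closed.

Record invariants := Invariants { inv_val : M; _ : inv_val \in inv_pred }.

HB.instance Definition _ := [isSub for inv_val].
HB.instance Definition _ := [Choice of invariants by <:].
HB.instance Definition _ := [SubChoice_isSubZmodule of invariants by <:].

Definition mk_inv (m : M) (hm : is_invariant m) : invariants :=
  Invariants (asboolT hm : m \in inv_pred).

Lemma invP (m : invariants) : is_invariant (val m).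
Proof. exact/asboolP/(valP m). Qed.
End ModuleTheory.

Section Restriction.
Variables (N G : groupType) (f : UMagmaMorphism.type N G).
Variables (M : zmodType) (rho : gmodule G M).

Definition res_act (n : N) (m : M) := rho (f n) m.
Lemma res_act1 m : res_act 1 m = m.
Proof. by rewrite /res_act gmulf1 gact1. Qed.
Lemma res_actM n n' m : res_act (n * n') m = res_act n (res_act n' m).
Proof. by rewrite /res_act gmulfM gactM. Qed.
Lemma res_actD n m m' : res_act n (m + m')%R = (res_act n m + res_act n m')%R.
Proof. exact: gactD. Qed.
Definition res : gmodule N M := GModule res_act1 res_actM res_actD.
End Restriction.

Section Descent.
Variables (N G Q : groupType) (S : short_exact N G Q).
Variables (A : zmodType) (rho : gmodule G A).
Hypothesis triv : forall n a, rho (ses_i S n) a = a.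

Lemma descend_fiber g g' a : ses_p S g = ses_p S g' -> rho g a = rho g' a.
Proof.
move=> eqp; have /(ses_exact S)[n en] : ses_p S (g'^-1 * g) = 1.
  by rewrite gmulfM gmulfV eqp mulVg.
by rewrite -(mulVKg g' g) -en gactM triv.
Qed.

Definition descend_act (q : Q) (a : A) := rho (sect S q) a.
Lemma descend_act1 a : descend_act 1 a = a.
Proof.
by rewrite -[RHS](gact1 rho); apply: descend_fiber; rewrite sectK gmulf1.
Qed.
Lemma descend_actM q q' a :
  descend_act (q * q') a = descend_act q (descend_act q' a).
Proof.
by rewrite /descend_act -gactM; apply: descend_fiber; rewrite gmulfM !sectK.
Qed.
Lemma descend_actD q a b :
  descend_act q (a + b)%R = (descend_act q a + descend_act q b)%R.
Proof. exact: gactD. Qed.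
Definition descend : gmodule Q A := GModule descend_act1 descend_actM descend_actD.

Lemma descendE g a : descend (ses_p S g) a = rho g a.
Proof. by apply: descend_fiber; rewrite sectK. Qed.
End Descent.

Section H1.
Variables (N : groupType) (M : zmodType) (rho : gmodule N M).

Definition is_der (d : N -> M) : Prop :=
  forall n n', d (n * n') = (d n + rho n (d n'))%R.
Definition der_pred : {pred N -> M} := [pred d | `[< is_der d >]].

Lemma der_zmod_closed : zmod_closed der_pred.
Proof.
split=> [|d d' /asboolP Hd /asboolP Hd']; apply/asboolP => n n' /=.
  by rewrite gact0 addr0.
by rewrite !fctE Hd Hd' gactB opprD addrACA.
Qed.
HB.instance Definition _ :=
  GRing.isZmodClosed.Build (N -> M) der_pred der_zmod_closed.

Record Der := MkDer { der_val :> N -> M; _ : der_val \in der_pred }.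

HB.instance Definition _ := [isSub for der_val].
HB.instance Definition _ := [Choice of Der by <:].
HB.instance Definition _ := [SubChoice_isSubZmodule of Der by <:].

Definition mk_der (d : N -> M) (hd : is_der d) : Der :=
  MkDer (asboolT hd : d \in der_pred).

Lemma derP (d : Der) : is_der d.
Proof. exact/asboolP/(valP d). Qed.

Lemma der1 (d : Der) : d 1 = 0%R.
Proof.
by apply: (addrI (d 1)); rewrite addr0 -{1}(gact1 rho (d 1)) addrC
  -[in RHS](mulg1 1) derP gact1.
Qed.

Lemma derV (d : Der) n : d n^-1 = (- rho (n^-1)%g (d n))%R.
Proof.
by apply/eqP; rewrite -addr_eq0 -derP mulVg der1.
Qed.

Definition is_inner (d : N -> M) : Prop :=
  exists m, forall n, d n = (rho n m - m)%R.
Definition Inn : {pred Der} := [pred d : Der | `[< is_inner d >]].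

Lemma Inn_zmod_closed : zmod_closed Inn.
Proof.
split=> [|d d' /asboolP[m Hm] /asboolP[m' Hm']]; apply/asboolP.
  by exists 0%R => n; rewrite gact0 subr0.
by exists (m - m')%R => n; rewrite -[LHS]/(d n - d' n)%R Hm Hm' gactB !opprD addrACA.
Qed.
HB.instance Definition _ := GRing.isZmodClosed.Build Der Inn Inn_zmod_closed.

Definition H1 : zmodType := Quotient.quot Inn.
Definition H1_class (d : Der) : H1 := \pi_(Quotient.quot Inn) d.
Definition H1_repr (x : H1) : Der := repr (x : Quotient.quot Inn).

Lemma H1_reprK x : H1_class (H1_repr x) = x.
Proof. exact: reprK. Qed.

Lemma H1_classP (d d' : Der) :
  H1_class d = H1_class d' <-> is_inner (fun n => d n - d' n)%R.
Proof.
rewrite /H1_class; split=> [/eqP|Hi]; last apply/eqP.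
  by rewrite -Quotient.idealrBE => /asboolP.
by rewrite -Quotient.idealrBE; apply/asboolP.
Qed.
End H1.

Section H2.
Variables (Q : groupType) (A : zmodType) (rho : gmodule Q A).

Definition is_cocycle (F : Q -> Q -> A) : Prop :=
  forall q1 q2 q3,
    (rho q1 (F q2 q3) + F q1 (q2 * q3)%g = F q1 q2 + F (q1 * q2)%g q3)%R.
Definition Z2_pred : {pred Q -> Q -> A} := [pred F | `[< is_cocycle F >]].

Lemma Z2_zmod_closed : zmod_closed Z2_pred.
Proof.
split=> [|F F' /asboolP HF /asboolP HF']; apply/asboolP => q1 q2 q3 /=.
  by rewrite gact0.
by rewrite !fctE gactB addrACA -opprD HF HF' opprD addrACA.
Qed.
HB.instance Definition _ :=
  GRing.isZmodClosed.Build (Q -> Q -> A) Z2_pred Z2_zmod_closed.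

Record Z2 := MkZ2 { Z2_val :> Q -> Q -> A; _ : Z2_val \in Z2_pred }.

HB.instance Definition _ := [isSub for Z2_val].
HB.instance Definition _ := [Choice of Z2 by <:].
HB.instance Definition _ := [SubChoice_isSubZmodule of Z2 by <:].

Definition mk_Z2 (F : Q -> Q -> A) (hF : is_cocycle F) : Z2 :=
  MkZ2 (asboolT hF : F \in Z2_pred).

Definition is_coboundary (F : Q -> Q -> A) : Prop :=
  exists c : Q -> A, forall q1 q2,
    F q1 q2 = (rho q1 (c q2) - c (q1 * q2)%g + c q1)%R.
Definition B2 : {pred Z2} := [pred F : Z2 | `[< is_coboundary F >]].

Lemma B2_zmod_closed : zmod_closed B2.
Proof.
split=> [|F F' /asboolP[c Hc] /asboolP[c' Hc']]; apply/asboolP.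
  by exists (fun=> 0%R) => q1 q2; rewrite gact0 subr0 addr0.
exists (c - c')%R => q1 q2; rewrite -[LHS]/(F q1 q2 - F' q1 q2)%R !fctE Hc Hc'.
by rewrite gactB !opprD !opprK addrACA (addrACA (rho _ _)).
Qed.
HB.instance Definition _ := GRing.isZmodClosed.Build Z2 B2 B2_zmod_closed.

Definition H2 : zmodType := Quotient.quot B2.
Definition H2_class (F : Z2) : H2 := \pi_(Quotient.quot B2) F.

Lemma H2_classP (F F' : Z2) :
  H2_class F = H2_class F' <-> is_coboundary (fun q1 q2 => F q1 q2 - F' q1 q2)%R.
Proof.
rewrite /H2_class; split=> [/eqP|Hi]; last apply/eqP.
  by rewrite -Quotient.idealrBE => /asboolP.
by rewrite -Quotient.idealrBE; apply/asboolP.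
Qed.

Definition represented_by (x : H2) (F : Q -> Q -> A) : Prop :=
  exists hF : is_cocycle F, x = H2_class (mk_Z2 hF).
End H2.

(* The class in H^2 of an extension of Q by the Q-module A is that of its     *)
(* factor set for the section sect S; by factor_set_cobound another section   *)
(* gives a cohomologous cocycle.                                              *)
Section ExtensionClass.
Variables (Q E : groupType) (A : zmodType) (rho : gmodule Q A).
Variable S : short_exact (Algebra.to_multiplicative A) E Q.

Definition compatible : Prop :=
  forall e (a : A), e * ses_i S a * e^-1 = ses_i S (rho (ses_p S e) a).

Definition is_section (sigma : Q -> E) : Prop :=
  forall q, ses_p S (sigma q) = q.
Definition is_factor_set (sigma : Q -> E) (F : Q -> Q -> A) : Prop :=
  forall q1 q2, sigma q1 * sigma q2 = ses_i S (F q1 q2) * sigma (q1 * q2).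

Definition factor_set (sigma : Q -> E) (q1 q2 : Q) : A :=
  preimg (ses_i S) (sigma q1 * sigma q2 * (sigma (q1 * q2))^-1).

Lemma factor_setP sigma : is_section sigma -> is_factor_set sigma (factor_set sigma).
Proof.
move=> hs q1 q2; rewrite /factor_set preimgK ?mulgVK //.
by apply/ses_exact; rewrite !gmulfM gmulfV !hs mulgV.
Qed.

Lemma ses_iD (a b : A) : ses_i S (a + b)%R = ses_i S a * ses_i S b.
Proof. exact: (@gmulfM _ _ (ses_i S) a b). Qed.

Hypothesis compat : compatible.

Lemma compatC e (a : A) : e * ses_i S a = ses_i S (rho (ses_p S e) a) * e.
Proof. by rewrite -compat mulgVK. Qed.

Lemma factor_set_cocycle sigma F :
  is_section sigma -> is_factor_set sigma F -> is_cocycle rho F.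
Proof.
move=> hs hF q1 q2 q3; apply: (@ses_inj _ _ _ S).
apply: (mulIg (sigma (q1 * (q2 * q3)))).
transitivity (sigma q1 * (sigma q2 * sigma q3)).
  by rewrite hF [RHS]mulgA compatC hs -[RHS]mulgA hF [RHS]mulgA -ses_iD.
by rewrite mulgA hF -mulgA hF [LHS]mulgA -ses_iD -[q1 * q2 * q3]mulgA.
Qed.

Definition ext_class : H2 rho :=
  H2_class (mk_Z2 (factor_set_cocycle (@sectK _ _ _ S) (factor_setP (@sectK _ _ _ S)))).

Lemma factor_set_cobound sigma sigma' F F' :
  is_section sigma -> is_section sigma' ->
  is_factor_set sigma F -> is_factor_set sigma' F' ->
  is_coboundary rho (fun q1 q2 => F' q1 q2 - F q1 q2)%R.
Proof.
move=> hs hs' hF hF'.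
have hc q : exists c : A, ses_i S c = sigma' q * (sigma q)^-1.
  by apply: (iffLR (ses_exact S _)); rewrite gmulfM gmulfV hs hs' mulgV.
pose c q : A := projT1 (cid (hc q)).
have Ec q : sigma' q = ses_i S (c q) * sigma q.
  by rewrite (projT2 (cid (hc q))) mulgVK.
exists c => q1 q2.
suff e : (F' q1 q2 + c (q1 * q2)%g = c q1 + (rho q1 (c q2) + F q1 q2))%R.
  have -> : F' q1 q2 = (c q1 + (rho q1 (c q2) + F q1 q2) - c (q1 * q2)%g)%R.
    by rewrite -e addrK.
  by rewrite addrAC (addrA (c q1)) addrK [RHS]addrAC (addrC (rho _ _)).
apply: (@ses_inj _ _ _ S); apply: (mulIg (sigma (q1 * q2))).
by rewrite !ses_iD -!mulgA -Ec -hF' -hF !Ec -mulgA (mulgA (sigma q1)) compatC hs -!mulgA.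
Qed.
End ExtensionClass.

Lemma ext_class_equiv (Q E E' : groupType) (A : zmodType) (rho : gmodule Q A)
    (S : short_exact (Algebra.to_multiplicative A) E Q)
    (S' : short_exact (Algebra.to_multiplicative A) E' Q)
    (cS : compatible rho S) (cS' : compatible rho S') (phi : E -> E') :
  {morph phi : x y / x * y} ->
  (forall a, phi (ses_i S a) = ses_i S' a) ->
  (forall e, ses_p S' (phi e) = ses_p S e) ->
  ext_class cS = ext_class cS'.
Proof.
move=> phiM phii phip; apply/H2_classP.
apply: (factor_set_cobound cS' (sigma := sect S')
  (sigma' := fun q => phi (sect S q)) (F := factor_set S' (sect S'))
  (F' := factor_set S (sect S))).
- exact: sectK.
- by move=> q; rewrite phip sectK.
- exact/factor_setP/sectK.
- move=> q1 q2; rewrite -phii -!phiM; congr phi.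
  exact: (factor_setP (@sectK _ _ _ S)).
Qed.

Definition sdprod (G : groupType) (M : zmodType) (rho : gmodule G M) : Type :=
  (M * G)%type.

Section SemidirectProduct.
Variables (G : groupType) (M : zmodType) (rho : gmodule G M).
Local Notation sdprod := (sdprod rho).

HB.instance Definition _ := Choice.copy sdprod (M * G)%type.

Definition sd_mul (x y : sdprod) : sdprod := ((x.1 + rho x.2 y.1)%R, x.2 * y.2).
Definition sd_one : sdprod := (0%R, 1).
Definition sd_inv (x : sdprod) : sdprod := ((- rho (x.2^-1)%g x.1)%R, x.2^-1).

Lemma sd_mulA : associative sd_mul.
Proof.
by move=> x y z; rewrite /sd_mul /= gactD gactM addrA mulgA.
Qed.
Lemma sd_mul1 : left_id sd_one sd_mul.
Proof. by move=> [m g]; rewrite /sd_mul /= gact1 add0r mul1g. Qed.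
Lemma sd_mulr1 : right_id sd_one sd_mul.
Proof. by move=> [m g]; rewrite /sd_mul /= gact0 addr0 mulg1. Qed.
Lemma sd_mulV : left_inverse sd_one sd_inv sd_mul.
Proof. by move=> [m g]; rewrite /sd_mul /sd_inv /= addNr mulVg. Qed.
Lemma sd_mulrV : right_inverse sd_one sd_inv sd_mul.
Proof. by move=> [m g]; rewrite /sd_mul /sd_inv /= gactN gactKV subrr mulgV. Qed.
HB.instance Definition _ :=
  isGroup.Build sdprod sd_mulA sd_mul1 sd_mulr1 sd_mulV sd_mulrV.

Lemma sdM (x y : sdprod) : x * y = ((x.1 + rho x.2 y.1)%R, x.2 * y.2) :> sdprod.
Proof. by []. Qed.
Lemma sdV (x : sdprod) : x^-1 = ((- rho (x.2^-1)%g x.1)%R, x.2^-1) :> sdprod.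
Proof. by []. Qed.
End SemidirectProduct.

Record subgroup (E : groupType) := Subgroup {
  sg_set :> E -> Prop;
  sg1 : sg_set 1;
  sgM : forall x y, sg_set x -> sg_set y -> sg_set (x * y);
  sgV : forall x, sg_set x -> sg_set x^-1
}.

Section Normalizer.
Variables (E : groupType) (H : subgroup E).

Definition normalizes (x : E) : Prop :=
  [set x * h * x^-1 | h in sg_set H]%classic = H.
Definition norm_pred : {pred E} := [pred x | `[< normalizes x >]].

Lemma normalizesP x :
  normalizes x <-> (forall h, H (x * h * x^-1) <-> H h).
Proof.
split=> [nx h | nx].
  split=> [Hh|Hh]; last by rewrite -nx; exists h.
  by move: Hh; rewrite -{1}nx => -[k Hk /mulIg/mulgI <-].
apply/seteqP; split=> [_ [h Hh <-]|h Hh]; first exact/nx.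
exists (x^-1 * h * x); last by rewrite !mulgA mulgV mul1g mulgK.
by apply/nx; rewrite !mulgA mulgV mul1g mulgK.
Qed.

Lemma norm_group_closed : group_closed norm_pred.
Proof.
split=> [|x y /asboolP/normalizesP nx /asboolP/normalizesP ny];
  apply/asboolP/normalizesP => h; first by rewrite mul1g invg1 mulg1.
have -> : x / y * h * (x / y)^-1 = x * (y^-1 * h * y) * x^-1.
  by rewrite invgM invgK !mulgA.
rewrite nx -(ny (y^-1 * h * y)).
by rewrite !mulgA mulgV mul1g mulgK.
Qed.

Record normalizer := Normalizer { norm_val : E; _ : norm_val \in norm_pred }.
HB.instance Definition _ := [isSub for norm_val].
HB.instance Definition _ := [Choice of normalizer by <:].
HB.instance Definition _ :=
  SubChoice_isSubGroup.Build E norm_pred normalizer norm_group_closed.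

Definition mk_norm (x : E) (hx : normalizes x) : normalizer :=
  Normalizer (asboolT hx : x \in norm_pred).

Lemma normP (x : normalizer) h : H (val x * h * (val x)^-1) <-> H h.
Proof. by have /asboolP/normalizesP := valP x; apply. Qed.

Definition coset_rel : rel normalizer :=
  fun x y => `[< H ((val x)^-1 * val y) >].

Lemma coset_rel_equiv : equiv_class_of coset_rel.
Proof.
split=> [x|x y|y x z].
- by apply/asboolP; rewrite mulVg; exact: sg1.
- by apply/asboolP/asboolP => /sgV; rewrite invgM invgK.
- move=> /asboolP Hxy /asboolP Hyz; apply/asboolP.
  by have := sgM Hxy Hyz; rewrite mulgA mulgK.
Qed.
Canonical coset_equiv := EquivRelPack coset_rel_equiv.
Canonical coset_encModRel := defaultEncModRel coset_rel.

Definition norm_quot := {eq_quot coset_rel}.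
HB.instance Definition _ : EqQuotient _ coset_rel norm_quot := EqQuotient.on norm_quot.
HB.instance Definition _ := Choice.on norm_quot.

Definition coset (x : normalizer) : norm_quot := \pi_norm_quot x.

Lemma cosetP x y : coset x = coset y <-> H ((val x)^-1 * val y).
Proof.
by split=> [/eqmodP/asboolP|Hxy]; last exact/eqmodP/asboolP.
Qed.

Lemma coset_surj (u : norm_quot) : exists x, u = coset x.
Proof. by exists (repr u); rewrite /coset reprK. Qed.

Definition nq_mul (u v : norm_quot) := coset (repr u * repr v).
Definition nq_one := coset 1.
Definition nq_inv (u : norm_quot) := coset (repr u)^-1.

Lemma coset_repr x : H ((val (repr (coset x)))^-1 * val x).
Proof. by apply/cosetP; rewrite /coset reprK. Qed.

Lemma nq_mulE x y : nq_mul (coset x) (coset y) = coset (x * y).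
Proof.
apply/cosetP; rewrite !valM invgM.
set y' := repr _; set x' := repr _.
have Hy : H ((val y')^-1 * val y) := coset_repr y.
have := sgM (y := (val y)^-1 * ((val x')^-1 * val x) * val y) Hy.
rewrite !mulgA mulgK; apply.
have := normP y^-1 ((val x')^-1 * val x).
rewrite (gmulfV (val : normalizer -> E)) invgK !mulgA => e.
by apply/e; exact: coset_repr.
Qed.

Lemma nq_invE x : nq_inv (coset x) = coset x^-1.
Proof.
apply/cosetP; rewrite !(gmulfV (val : normalizer -> E)) invgK.
set x' := repr _.
have /sgV := coset_repr x; rewrite invgM invgK -(normP x).
by rewrite !mulgA mulgV mul1g.
Qed.

Lemma nq_mulA : associative nq_mul.
Proof.
move=> u v w; have [x ->] := coset_surj u; have [y ->] := coset_surj v.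
by have [z ->] := coset_surj w; rewrite !nq_mulE mulgA.
Qed.
Lemma nq_mul1 : left_id nq_one nq_mul.
Proof. by move=> u; have [x ->] := coset_surj u; rewrite nq_mulE mul1g. Qed.
Lemma nq_mulr1 : right_id nq_one nq_mul.
Proof. by move=> u; have [x ->] := coset_surj u; rewrite nq_mulE mulg1. Qed.
Lemma nq_mulV : left_inverse nq_one nq_inv nq_mul.
Proof.
by move=> u; have [x ->] := coset_surj u; rewrite nq_invE nq_mulE mulVg.
Qed.
Lemma nq_mulrV : right_inverse nq_one nq_inv nq_mul.
Proof.
by move=> u; have [x ->] := coset_surj u; rewrite nq_invE nq_mulE mulgV.
Qed.
HB.instance Definition _ :=
  isGroup.Build norm_quot nq_mulA nq_mul1 nq_mulr1 nq_mulV nq_mulrV.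

Lemma cosetM : {morph coset : x y / x * y}.
Proof. by move=> x y; rewrite -nq_mulE. Qed.
End Normalizer.

Section Transgression.
Variables (N G Q : groupType) (S : short_exact N G Q).
Variables (M : zmodType) (rho : gmodule G M).

Local Notation i := (ses_i S).
Local Notation p := (ses_p S).

Definition resN : gmodule N M := res i rho.
Definition MN : zmodType := invariants resN.

(* conjN g n is g^-1 n g, seen in N; mathcomp's x ^ y is y^-1 x y. *)
Definition conjN (g : G) (n : N) : N := preimg i (i n ^ g).

Lemma conjNK g n : i (conjN g n) = i n ^ g.
Proof.
by rewrite preimgK //; apply/ses_exact; rewrite gmulfJ ses_pi conj1g.
Qed.

Lemma conjNM g n n' : conjN g (n * n') = conjN g n * conjN g n'.
Proof. by apply: (ses_inj (s := S)); rewrite gmulfM !conjNK gmulfM conjMg. Qed.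

Lemma conjN_comp g h n : conjN h (conjN g n) = conjN (g * h) n.
Proof. by apply: (ses_inj (s := S)); rewrite !conjNK conjgM. Qed.

Lemma conjN1 n : conjN 1 n = n.
Proof. by apply: (ses_inj (s := S)); rewrite conjNK conjg1. Qed.

Lemma conjNi x n : conjN (i x) n = n ^ x.
Proof. by apply: (ses_inj (s := S)); rewrite conjNK gmulfJ. Qed.

Lemma rho_conj g n m : rho (i n) (rho g m) = rho g (rho (i (conjN g n)) m).
Proof. by rewrite -!gactM conjNK /conjg mulVKg. Qed.

Lemma MN_act_inv g (m : MN) : is_invariant resN (rho g (val m)).
Proof. by move=> n; rewrite /= /res_act rho_conj; congr (rho g _); exact: (invP m). Qed.
Definition MN_act g (m : MN) : MN := mk_inv (MN_act_inv g m).
Lemma MN_act1 m : MN_act 1 m = m.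
Proof. by apply: val_inj; rewrite /= gact1. Qed.
Lemma MN_actM g h m : MN_act (g * h) m = MN_act g (MN_act h m).
Proof. by apply: val_inj; rewrite /= gactM. Qed.
Lemma MN_actD g m m' : MN_act g (m + m')%R = (MN_act g m + MN_act g m')%R.
Proof. by apply: val_inj; rewrite /= gactD. Qed.
Definition MN_G : gmodule G MN := GModule MN_act1 MN_actM MN_actD.

Lemma MN_triv n m : MN_G (i n) m = m.
Proof. by apply: val_inj; exact: (invP m). Qed.
Definition MN_Q : gmodule Q MN := descend MN_triv.

(* The Q-module structure on H^1(N, M), induced by (gd)(n) = g.d(g^-1 n g). *)
Local Notation DerN := (Der resN).

Definition der_act_fun (g : G) (d : DerN) (n : N) : M := rho g (d (conjN g n)).
Lemma der_act_der g d : is_der resN (der_act_fun g d).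
Proof.
move=> n n'; rewrite /der_act_fun conjNM derP gactD.
by rewrite {2}/resN /= /res_act rho_conj.
Qed.
Definition der_act g (d : DerN) : DerN := mk_der (der_act_der g d).

Definition H1_act (g : G) (x : H1 resN) : H1 resN :=
  H1_class (der_act g (H1_repr x)).

Lemma H1_act_class g (d : DerN) : H1_act g (H1_class d) = H1_class (der_act g d).
Proof.
apply/H1_classP.
have /H1_classP[m Hm] : H1_class (H1_repr (H1_class d)) = H1_class d.
  by rewrite H1_reprK.
exists (rho g m) => n; rewrite /= /der_act_fun -gactB Hm gactB.
by rewrite /resN /= /res_act rho_conj.
Qed.

Lemma H1_class_surj (x : H1 resN) : exists d, x = H1_class d.
Proof.
by exists (H1_repr x); rewrite H1_reprK.
Qed.

Lemma H1_classD (d d' : DerN) : H1_class (d + d')%R = (H1_class d + H1_class d')%R.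
Proof. by rewrite /H1_class raddfD. Qed.

Lemma H1_act1 x : H1_act 1 x = x.
Proof.
have [d ->] := H1_class_surj x; rewrite H1_act_class; congr H1_class.
apply/val_inj/funext => n.
by rewrite /= /der_act_fun conjN1 gact1.
Qed.
Lemma H1_actM g h x : H1_act (g * h) x = H1_act g (H1_act h x).
Proof.
have [d ->] := H1_class_surj x; rewrite !H1_act_class; congr H1_class.
by apply/val_inj/funext => n; rewrite /= /der_act_fun /= /der_act_fun gactM conjN_comp.
Qed.
Lemma H1_actD g x y : H1_act g (x + y)%R = (H1_act g x + H1_act g y)%R.
Proof.
have [d ->] := H1_class_surj x; have [d' ->] := H1_class_surj y.
rewrite -H1_classD !H1_act_class -H1_classD; congr H1_class.
by apply/val_inj/funext => n; rewrite /= /der_act_fun gactD.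
Qed.
Definition H1_G : gmodule G (H1 resN) := GModule H1_act1 H1_actM H1_actD.

Lemma der_act_i n (d : DerN) x :
  der_act_fun (i n) d x = (d x + rho (i x) (d n) - d n)%R.
Proof.
rewrite /der_act_fun conjNi -(derP d x n) conjgC (derP d n (x ^ n)).
by rewrite addrAC subrr add0r.
Qed.

Lemma H1_triv n x : H1_G (i n) x = x.
Proof.
have [d ->] := H1_class_surj x; rewrite /= H1_act_class; apply/H1_classP.
exists (d n) => x'; rewrite -[LHS]/(der_act_fun (i n) d x' - d x')%R der_act_i.
by rewrite addrAC (addrAC (d x')) subrr add0r.
Qed.
Definition H1_Q : gmodule Q (H1 resN) := descend H1_triv.

Definition H1_inv : zmodType := invariants H1_Q.

(* The subgroup H = s(N) of the semidirect product, with s n = (d n, n). *)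
Section Splitting.
Variable d : DerN.

Definition der_lift (n : N) : sdprod rho := (d n, i n).

Lemma der_liftM n n' : der_lift (n * n') = der_lift n * der_lift n'.
Proof. by rewrite /der_lift derP gmulfM. Qed.
Lemma der_lift1 : der_lift 1 = 1.
Proof. by rewrite /der_lift der1 gmulf1. Qed.

Definition lift_set (x : sdprod rho) : Prop := exists n, der_lift n = x.
Lemma lift_set1 : lift_set 1.
Proof. by exists 1; rewrite der_lift1. Qed.
Lemma lift_setM x y : lift_set x -> lift_set y -> lift_set (x * y).
Proof. by move=> [n <-] [n' <-]; exists (n * n'); rewrite der_liftM. Qed.
Lemma lift_setV x : lift_set x -> lift_set x^-1.
Proof.
move=> [n <-]; exists n^-1; apply: (mulIg (der_lift n)).
by rewrite -der_liftM !mulVg der_lift1.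
Qed.
Definition lift_image : subgroup (sdprod rho) :=
  Subgroup lift_set1 lift_setM lift_setV.

Lemma lift_imageP m n : lift_image (m, i n) <-> m = d n.
Proof.
split=> [[n' [<- /(ses_inj (s := S)) ->]] // | ->]; by exists n.
Qed.

Lemma lift_im_p x : lift_image x -> exists n, x = (d n, i n).
Proof. by move=> [n <-]; exists n. Qed.

Lemma lift_normP m g :
  normalizes lift_image (m, g) <->
  (forall n, m + der_act_fun g d n - rho (i n) m = d n)%R.
Proof.
have E n : ((m, g) : sdprod rho) * der_lift (conjN g n) * ((m, g) : sdprod rho)^-1 =
     ((m + der_act_fun g d n - rho (i n) m)%R, i n) :> sdprod rho.
  rewrite sdV !sdM /=; have Eg : g * i (conjN g n) / g = i n.
    by rewrite conjNK /conjg mulVKg mulgK.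
  by rewrite Eg gactN -gactM Eg.
split=> [/normalizesP nx n | Hn].
  by apply/lift_imageP; rewrite -E; apply/nx; exists (conjN g n).
apply/seteqP; split=> [_ [_ [n <-] <-]|_ [n <-]].
  exists (conjN g^-1 n).
  have := E (conjN g^-1 n); rewrite conjN_comp mulVg conjN1 Hn => -> //.
exists (der_lift (conjN g n)); first by exists (conjN g n).
by rewrite E Hn.
Qed.

Local Notation NH := (normalizer lift_image).

Definition norm_proj (x : NH) : G := (val x).2.

Lemma MN_norm (m : MN) : normalizes lift_image (val m, 1).
Proof.
apply/lift_normP => n; rewrite /der_act_fun conjN1 gact1.
have /= := invP m n; rewrite /res_act => ->.
by rewrite addrAC subrr add0r.
Qed.
Definition norm_inj (m : MN) : NH := mk_norm (MN_norm m).

Lemma norm_injD m m' : norm_inj (m + m')%R = norm_inj m * norm_inj m'.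
Proof.
by apply: val_inj; rewrite valM sdM /= gact1 mulg1.
Qed.

Definition ibar (m : Algebra.to_multiplicative MN) : norm_quot lift_image :=
  coset (norm_inj m).

Lemma ibarF : {morph ibar : x y / x / y}.
Proof.
have ibarM : {morph ibar : x y / x * y}.
  by move=> x y; rewrite /ibar -cosetM -norm_injD.
move=> x y; apply: (mulIg (ibar y)).
by rewrite -ibarM !mulgVK.
Qed.
HB.instance Definition _ := isGroupMorphism.Build _ _ ibar ibarF.

Definition pbar (u : norm_quot lift_image) : Q := p (norm_proj (repr u)).

Lemma pbar_coset x : pbar (coset x) = p (norm_proj x).
Proof.
rewrite /pbar /norm_proj; have [n [_ Hn]] := coset_repr x.
have : p (i n) = 1 by exact: ses_pi.
rewrite Hn gmulfM gmulfV => /(congr1 (fun y => p (val (repr (coset x))).2 * y)).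
by rewrite mulVKg mulg1.
Qed.

Lemma pbarF : {morph pbar : x y / x / y}.
Proof.
have pbarM : {morph pbar : x y / x * y}.
  move=> u v; have [x ->] := coset_surj u; have [y ->] := coset_surj v.
  by rewrite -cosetM !pbar_coset /norm_proj valM sdM /= gmulfM.
move=> x y; apply: (mulIg (pbar y)).
by rewrite -pbarM !mulgVK.
Qed.
HB.instance Definition _ := isGroupMorphism.Build _ _ pbar pbarF.

Lemma ibar_inj : injective ibar.
Proof.
move=> m m' /cosetP; rewrite /= sdV sdM /= invg1 !gact1 mulg1 => -[n].
rewrite /der_lift => -[Hd Hi].
have n1 : n = 1 by apply: (ses_inj (s := S)); rewrite Hi gmulf1.
apply: val_inj; move: Hd; rewrite n1 der1 => /esym/eqP.
by rewrite addrC subr_eq0 => /eqP.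
Qed.

Definition ibar_inv (u : norm_quot lift_image) : MN := preimg ibar u.

Lemma ext_exact u : pbar u = 1 <-> exists m, ibar m = u.
Proof.
split=> [|[m <-]]; last by rewrite /ibar pbar_coset /norm_proj /= gmulf1.
have [x ->] := coset_surj u; rewrite pbar_coset => /ses_exact[n Hn].
case: x Hn => -[m g] hx; rewrite /norm_proj /= => Hg; subst g.
have /asboolP/lift_normP Hx := hx.
have im : is_invariant resN (m - d n)%R.
  move=> x; apply/esym/eqP; rewrite gactB -subr_eq0; apply/eqP.
  apply: (addrI (d x)); rewrite addr0 -[RHS]Hx der_act_i.
  rewrite opprB -(addrA (d x)) (addrCA m (d x)) -[RHS]addrA; congr (_ + _)%R.
  by rewrite addrACA !addrA.
exists (mk_inv im); apply/cosetP; exists n.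
rewrite /= sdV sdM /= invg1 mul1g !gact1 /der_lift; congr (_, _).
by rewrite opprB subrK.
Qed.

Hypothesis hd : is_invariant H1_Q (H1_class d).

Lemma ext_surj q : exists u, pbar u = q.
Proof.
have [g <-] := ses_surj S q.
have := hd (p g); rewrite /H1_Q descendE /= H1_act_class => /H1_classP[m Hm].
have nx : normalizes lift_image (m, g).
  apply/lift_normP => n.
  have e : (der_act_fun g d n - d n = rho (i n) m - m)%R by exact: (Hm n).
  rewrite -(subrK (d n) (der_act_fun g d n)) e addrA (addrC m) subrK.
  by rewrite addrAC subrr add0r.
by exists (coset (mk_norm nx)); rewrite pbar_coset.
Qed.

Definition tr_ext : short_exact (Algebra.to_multiplicative MN) (norm_quot lift_image) Q :=
  ShortExact (ses_i := ibar) (ses_p := pbar) ibar_inj ext_exact ext_surj.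

Lemma tr_ext_compat : compatible MN_Q tr_ext.
Proof.
move=> u m; have [x ->] := coset_surj u.
suff e : coset x * ibar m = ibar (MN_Q (pbar (coset x)) m) * coset x.
  by rewrite -[ses_i tr_ext _]/(ibar m) e mulgK.
rewrite pbar_coset /MN_Q descendE /ibar -!cosetM; congr coset; apply: val_inj.
by rewrite !valM !sdM /= gact1 mulg1 mul1g addrC.
Qed.

Definition tr_ext_class : H2 MN_Q := ext_class tr_ext_compat.
End Splitting.

Lemma repr_inv (x : H1_inv) :
  is_invariant H1_Q (H1_class (H1_repr (val x))).
Proof. rewrite H1_reprK; exact: invP. Qed.

(* tr x is computed from a chosen derivation in the class x; trE below shows  *)
(* that any other derivation in that class gives the same value.              *)
Definition tr (x : H1_inv) : H2 MN_Q := tr_ext_class (repr_inv x).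

Section Independence.
Variables (d d' : DerN) (m : M).
Hypothesis dd' : forall n, (d' n - d n = rho (i n) m - m)%R.

Local Notation NH := (normalizer (lift_image d)).
Local Notation NH' := (normalizer (lift_image d')).
Let c : sdprod rho := ((- m)%R, 1).

Lemma conj_lift n : c * der_lift d n * c^-1 = der_lift d' n.
Proof.
rewrite sdV !sdM /= invg1 mul1g mulg1 !gact1 opprK; congr (_, _).
by rewrite -[RHS](subrK (d n)) dd' -[RHS]addrA [RHS]addrC.
Qed.

Lemma conj_liftP y : lift_image d' (c * y * c^-1) <-> lift_image d y.
Proof.
split=> -[n]; last by move=> <-; exists n; rewrite conj_lift.
by rewrite -conj_lift => /mulIg/mulgI <-; exists n.
Qed.

Lemma conj_norm (x : NH) : normalizes (lift_image d') (c * val x * c^-1).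
Proof.
apply/normalizesP => h.
have {1}-> : h = c * (c^-1 * h * c) * c^-1 by rewrite !mulgA mulgV mul1g mulgK.
have -> : c * val x * c^-1 * (c * (c^-1 * h * c) * c^-1) * (c * val x * c^-1)^-1
  = c * (val x * (c^-1 * h * c) * (val x)^-1) * c^-1.
  by rewrite !invgM invgK !mulgA !mulgVK.
rewrite conj_liftP normP -conj_liftP.
by rewrite !mulgA mulgV mul1g mulgK.
Qed.
Definition conj_rep (x : NH) : NH' := mk_norm (conj_norm x).
Definition conj_quot (u : norm_quot (lift_image d)) : norm_quot (lift_image d') :=
  coset (conj_rep (repr u)).

Lemma conj_quot_coset x : conj_quot (coset x) = coset (conj_rep x).
Proof.
apply/cosetP; rewrite /= !invgM invgK -!mulgA mulKg !mulgA.
have /conj_liftP := coset_repr x; by rewrite !mulgA.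
Qed.

Lemma tr_ext_class_indep (hd : is_invariant H1_Q (H1_class d))
    (hd' : is_invariant H1_Q (H1_class d')) :
  tr_ext_class hd = tr_ext_class hd'.
Proof.
apply: (@ext_class_equiv _ _ _ _ _ _ _ _ _ conj_quot).
- move=> u v; have [x ->] := coset_surj u; have [y ->] := coset_surj v.
  rewrite -cosetM !conj_quot_coset -cosetM; congr coset; apply: val_inj.
  by rewrite /= !mulgA mulgVK.
- move=> a; rewrite -[LHS]/(conj_quot (coset _)) conj_quot_coset.
  congr coset; apply: val_inj.
  rewrite /= sdV !sdM /= invg1 !mul1g !gact1 opprK; congr (_, _).
  by rewrite addrC addrA subrr add0r.
- move=> u; have [x ->] := coset_surj u.
  rewrite conj_quot_coset -[LHS]/(pbar _) -[RHS]/(pbar _) !pbar_coset.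
  by rewrite /norm_proj /= invg1 mul1g mulg1.
Qed.
End Independence.

Lemma trE (d : DerN) (hd : is_invariant H1_Q (H1_class d)) :
  tr (mk_inv hd) = tr_ext_class hd.
Proof.
have /H1_classP[m Hm] : H1_class d = H1_class (H1_repr (H1_class d)).
  by rewrite H1_reprK.
exact: (tr_ext_class_indep Hm).
Qed.
End Transgression.

(* Main.v *)
Require Import Defs.
From mathcomp Require Import all_boot ssralg.
From mathcomp Require Import boolp classical_sets functions.

Set Implicit Arguments.
Unset Strict Implicit.
Unset Printing Implicit Defensive.

Import GRing.Theory.
Local Open Scope group_scope.

(** Composing [stilde] with [alpha] and with the projection onto the quotient
    by [H] gives a section [q |-> stilde (alpha q) H] of the extension whose
    class is the transgression of [d], so its factor set represents that class:
    a change of section changes the factor set by a coboundary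
    ([factor_set_represents]).  To compute this factor set
    ([transgression_factor_set]), write
      [stilde a1 * stilde a2 = f_s a1 a2 * stilde (f * a12)],
      [stilde f * stilde a12 = f_s f a12 * stilde (f * a12)],
    where [a1 * a2 = f * a12] in [G], with [f] in [N].  Eliminating
    [stilde (f * a12)] leaves [f_s a1 a2 - f_s f a12] together with the coset
    of [stilde f].  This coset lies over the trivial element of [Q], hence
    comes from an invariant of [M]; that invariant is zero when [stilde]
    agrees on [N] with [n |-> (d n, n)], because then [stilde f] belongs
    to [H]. *)

Section ExtensionRepresentatives.
Variables (Q E : groupType) (A : zmodType) (rho : gmodule Q A).
Variable S : short_exact (Algebra.to_multiplicative A) E Q.

(** [ext_class] is computed from one chosen section; any other section gives a
    cocycle, by associativity in [E], that differs by a coboundary. *)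
Lemma factor_set_represents (cS : compatible rho S) (sigma : Q -> E)
    (F : Q -> Q -> A) :
  is_section S sigma -> is_factor_set S sigma F ->
  represented_by (ext_class cS) F.
Proof.
move=> hs hF; exists (factor_set_cocycle cS hs hF); apply/H2_classP.
apply: (factor_set_cobound cS hs _ hF); first exact: sectK.
exact/factor_setP/sectK.
Qed.
End ExtensionRepresentatives.

Section TransgressionCocycle.
Variables (N G Q : groupType) (S : short_exact N G Q).
Variables (M : zmodType) (rho : gmodule G M) (d : Der (resN S rho)).

Lemma ibarD (a b : MN S rho) : ibar d (a + b)%R = ibar d a * ibar d b.
Proof. by rewrite /ibar -cosetM -norm_injD. Qed.

Lemma ibar0 : ibar d (0 : MN S rho)%R = 1.
Proof. by apply: (mulIg (ibar d 0%R)); rewrite -ibarD addr0 mul1g. Qed.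

Lemma ibarN (a : MN S rho) : ibar d (- a)%R = (ibar d a)^-1.
Proof. exact: (@gmulfV _ _ (ibar d) a). Qed.

Lemma coset_lift (x : normalizer (lift_image d)) n :
  val x = der_lift d n -> coset x = 1.
Proof.
move=> xE; apply/esym/cosetP; exists n.
by rewrite gmulf1 invg1 mul1g.
Qed.

Variable stilde : G -> normalizer (lift_image d).
Hypothesis stilde_section : forall g, norm_proj (stilde g) = g.

Lemma pbar_stilde g : pbar (coset (stilde g)) = ses_p S g.
Proof. by rewrite pbar_coset stilde_section. Qed.

Lemma coset_stilde_ker n : exists m : MN S rho,
  ibar d m = coset (stilde (ses_i S n)).
Proof. by apply/ext_exact; rewrite pbar_stilde ses_pi. Qed.

Variable f_s : G -> G -> MN S rho.
Hypothesis f_sP : forall g g',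
  stilde g * stilde g' = norm_inj d (f_s g g') * stilde (g * g').

Lemma coset_stildeM g g' :
  coset (stilde g) * coset (stilde g') =
  ibar d (f_s g g') * coset (stilde (g * g')).
Proof. by rewrite -!cosetM f_sP. Qed.

Variables (alpha : Q -> G) (f_alpha : Q -> Q -> N).
Hypothesis alpha_section : forall q, ses_p S (alpha q) = q.
Hypothesis f_alphaP : forall q q',
  alpha q * alpha q' = ses_i S (f_alpha q q') * alpha (q * q').
Hypothesis d_inv : is_invariant (H1_Q S rho) (H1_class d).

(** The invariants [c q1 q2] are kept abstract so that both the case where they
    vanish and the case where they are read off from [stilde] are covered. *)
Lemma transgression_factor_set (c : Q -> Q -> MN S rho) :
  (forall q1 q2, ibar d (c q1 q2) = coset (stilde (ses_i S (f_alpha q1 q2)))) ->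
  is_factor_set (tr_ext d_inv) (fun q => coset (stilde (alpha q)))
    (fun q1 q2 => f_s (alpha q1) (alpha q2)
       - f_s (ses_i S (f_alpha q1 q2)) (alpha (q1 * q2)%g) + c q1 q2)%R.
Proof.
move=> cE q1 q2; rewrite -[ses_i _ _]/(ibar d _) !ibarD ibarN cE.
by rewrite -[RHS]mulgA !coset_stildeM f_alphaP -[RHS]mulgA mulKg.
Qed.

Lemma transgression_represented (c : Q -> Q -> MN S rho) :
  (forall q1 q2, ibar d (c q1 q2) = coset (stilde (ses_i S (f_alpha q1 q2)))) ->
  represented_by (tr (mk_inv d_inv))
    (fun q1 q2 => f_s (alpha q1) (alpha q2)
       - f_s (ses_i S (f_alpha q1 q2)) (alpha (q1 * q2)%g) + c q1 q2)%R.
Proof.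
move=> cE; rewrite trE.
apply: factor_set_represents (transgression_factor_set cE) => q.
by rewrite -[ses_p _ _]/(pbar _) pbar_stilde.
Qed.
End TransgressionCocycle.

Unset Implicit Arguments.
Set Strict Implicit.

Theorem mainTheorem3
    (N G Q : groupType) (S : short_exact N G Q)
    (M : zmodType) (rho : gmodule G M)
    (alpha : Q -> G) (f_alpha : Q -> Q -> N)
    (alpha_section : forall q, ses_p S (alpha q) = q)
    (f_alphaP : forall q q',
       alpha q * alpha q' = ses_i S (f_alpha q q') * alpha (q * q'))
    (d : Der (resN S rho))
    (d_inv : is_invariant (H1_Q S rho) (H1_class d))
    (stilde : G -> normalizer (lift_image d))
    (stilde_section : forall g, norm_proj (stilde g) = g)
    (f_s : G -> G -> MN S rho)
    (f_sP : forall g g',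
       stilde g * stilde g' = norm_inj d (f_s g g') * stilde (g * g')) :
  ((forall n, val (stilde (ses_i S n)) = der_lift d n) ->
   represented_by (tr (mk_inv d_inv))
     (fun q1 q2 => f_s (alpha q1) (alpha q2)
        - f_s (ses_i S (f_alpha q1 q2)) (alpha (q1 * q2)%g))%R)
  /\
  ((forall q1 q2, exists m : MN S rho,
      ibar d m = coset (stilde (ses_i S (f_alpha q1 q2)))) /\
   represented_by (tr (mk_inv d_inv))
     (fun q1 q2 => f_s (alpha q1) (alpha q2)
        - f_s (ses_i S (f_alpha q1 q2)) (alpha (q1 * q2)%g)
        + ibar_inv (coset (stilde (ses_i S (f_alpha q1 q2)))))%R).
Proof.
have key := transgression_represented stilde_section f_sP alpha_section
  f_alphaP d_inv.
have ker q1 q2 := coset_stilde_ker stilde_section (f_alpha q1 q2).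
split=> [stilde_ext|].
  have c0 q1 q2 : ibar d (0 : MN S rho)%R =
      coset (stilde (ses_i S (f_alpha q1 q2))).
    by rewrite (coset_lift (stilde_ext _)) ibar0.
  have := key (fun _ _ => 0%R) c0.
  by under eq_fun do under eq_fun do rewrite addr0.
split=> //; apply: (key (fun q1 q2 =>
  ibar_inv (coset (stilde (ses_i S (f_alpha q1 q2)))))) => q1 q2.
exact: (@preimgK _ _ (ibar d) _ (ker q1 q2)).
Qed.
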